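(* Let $0<l_2\le l_1$ be real numbers, and put $$c^*=\tfrac12\left(l_1+l_2+\sqrt{l_1^2+l_2^2-l_1l_2}\right),\quad a^*=\frac{c^*}{2c^*/l_1-1},\quad b^*=\frac{c^*}{2c^*/l_2-1},\quad m_a^*=b^*+\tfrac12a^*.$$ For a real number $x$ consider the triangles $ABC$ with $l_a=l_2$, $l_b=l_1$ and $m_a=x$. If $l_2<x<m_a^*$, there exist exactly two such triangles. If $m_a^*\le x<\infty$ or $x=l_2$, there exists a unique such triangle. For all other values of $x$ no such triangle exists.
   Context: For a non-degenerate triangle $ABC$ in the Euclidean plane, $l_a$ and $l_b$ denote the lengths of the internal angle bisectors drawn from $A$ and $B$ respectively, measured from the vertex to the opposite side; $m_a$ is the length of the median from $A$ to the midpoint of $BC$. Triangles are counted up to congruence respecting the vertex labels. *)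

(* Defs.v *)
From Stdlib Require Import Reals.
Open Scope R_scope.

Definition point : Type := (R * R)%type.

Definition pdist (P Q : point) : R :=
  dist_euc (fst P) (snd P) (fst Q) (snd Q).

Definition collinear (P Q S : point) : Prop :=
  exists u v w : R, (u <> 0 \/ v <> 0) /\
    u * fst P + v * snd P = w /\
    u * fst Q + v * snd Q = w /\
    u * fst S + v * snd S = w.

Record plane_triangle : Type := PlaneTriangle {
  vA : point;
  vB : point;
  vC : point;
  nondegenerate : ~ collinear vA vB vC
}.

(* Distance-preserving maps of the plane, orientation-reversing ones included;
   they are automatically bijective. *)
Definition isometry (f : point -> point) : Prop :=
  forall P Q : point, pdist (f P) (f Q) = pdist P Q.

Definition congruent (T T' : plane_triangle) : Prop :=
  exists f : point -> point, isometry f /\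
    f (vA T) = vA T' /\ f (vB T) = vB T' /\ f (vC T) = vC T'.

Definition on_segment (P Q D : point) : Prop :=
  exists t : R, 0 <= t <= 1 /\
    D = ((1 - t) * fst P + t * fst Q, (1 - t) * snd P + t * snd Q).

Definition midpoint (P Q : point) : point :=
  ((fst P + fst Q) / 2, (snd P + snd Q) / 2).

(* The unoriented angle POQ, in [0, PI]; meaningful for P <> O and Q <> O. *)
Definition angle (P O Q : point) : R :=
  acos (((fst P - fst O) * (fst Q - fst O) + (snd P - snd O) * (snd Q - snd O))
        / (pdist O P * pdist O Q)).

(* When P, Q, S are not collinear, exactly one point D of the segment QS
   satisfies the angle condition, so l is determined by P, Q, S. *)
Definition bisector_length (P Q S : point) (l : R) : Prop :=
  exists D : point,
    on_segment Q S D /\ angle Q P D = angle D P S /\ pdist P D = l.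

Definition is_la (T : plane_triangle) (l : R) : Prop :=
  bisector_length (vA T) (vB T) (vC T) l.

Definition is_lb (T : plane_triangle) (l : R) : Prop :=
  bisector_length (vB T) (vC T) (vA T) l.

Definition ma (T : plane_triangle) : R := pdist (vA T) (midpoint (vB T) (vC T)).

Definition exists_unique_triangle (P : plane_triangle -> Prop) : Prop :=
  exists T : plane_triangle, P T /\ forall T' : plane_triangle, P T' -> congruent T' T.

Definition exists_exactly_two_triangles (P : plane_triangle -> Prop) : Prop :=
  exists T1 T2 : plane_triangle, P T1 /\ P T2 /\ ~ congruent T1 T2 /\
    forall T : plane_triangle, P T -> congruent T T1 \/ congruent T T2.

Definition c_star (l1 l2 : R) : R :=
  (l1 + l2 + sqrt (l1 ^ 2 + l2 ^ 2 - l1 * l2)) / 2.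

Definition a_star (l1 l2 : R) : R :=
  c_star l1 l2 / (2 * c_star l1 l2 / l1 - 1).

Definition b_star (l1 l2 : R) : R :=
  c_star l1 l2 / (2 * c_star l1 l2 / l2 - 1).

Definition ma_star (l1 l2 : R) : R := b_star l1 l2 + a_star l1 l2 / 2.

Definition solution (l1 l2 x : R) (T : plane_triangle) : Prop :=
  is_la T l2 /\ is_lb T l1 /\ ma T = x.

(* Main.v *)
Require Import Defs.
From Stdlib Require Import Reals Lra Psatz Ranalysis5.
From Coquelicot Require Import Rcomplements.
Open Scope R_scope.

(** With sides a, b, c, put [bisector_sq p q r = pq(1 - (r/(p+q))^2)], so that
    l_a^2 = [bisector_sq b c a] and l_b^2 = [bisector_sq a c b].

    Since [bisector_sq p q r] increases in p and q, and also along p + t, r + t,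
    two triangles with the same l_a satisfy: if b and c do not decrease, then a
    grows by at least as much as b, strictly unless b and c are unchanged.  By
    symmetry, with the same l_b, b grows by more than a, which is absurd.  So
    among triangles with given l_a and l_b, c decreases strictly when b
    increases.  As 4(m_a^2 - l_a^2) = (b - c)^2 (1 + l_a^2/(bc)), the median is
    then strictly monotone on each of the branches c <= b and b <= c, and a
    comparison with the flat triangle a*, b*, c* = a* + b* bounds it by m_a* on
    the second one.

    For existence, l_a, m_a and the sign of b - c leave a one-parameter family
    of triangles, parametrised by bc in (l_a m_a, +oo); the intermediate value
    theorem for l_b applies, the end bc = l_a m_a being a flat triangle. *)

(** * The squared bisector length as a function of the sides *)

Definition bisector_sq (p q r : R) : R := p * q * (1 - (r / (p + q)) ^ 2).

Lemma bisector_sqC (p q r : R) : bisector_sq p q r = bisector_sq q p r.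
Proof. unfold bisector_sq. rewrite (Rplus_comm p q). ring. Qed.

Lemma bisector_sq_scale (s p q r : R) :
  0 < s -> 0 < p + q ->
  bisector_sq (s * p) (s * q) (s * r) = s ^ 2 * bisector_sq p q r.
Proof.
  intros Hs Hpq. unfold bisector_sq.
  replace (s * r / (s * p + s * q)) with (r / (p + q)); [ring|].
  field. split; nra.
Qed.

Lemma bisector_sq_opp_lt (p q r r' : R) :
  0 < p -> 0 < q -> 0 <= r < r' -> bisector_sq p q r' < bisector_sq p q r.
Proof.
  intros Hp Hq Hr. unfold bisector_sq.
  assert (Hi : 0 < / (p + q)) by (apply Rinv_0_lt_compat; lra).
  assert (H1 : 0 <= r / (p + q)) by (unfold Rdiv; nra).
  assert (H2 : r / (p + q) < r' / (p + q)) by (unfold Rdiv; nra).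
  apply Rmult_lt_compat_l; nra.
Qed.

(** Both factors grow with [p]. Strictness comes from [p * q], multiplied by the second factor at
    [p']; that factor is positive even when [r = p + q], the flat case. *)
Lemma bisector_sq_left_lt (p p' q r : R) :
  0 < p < p' -> 0 < q -> 0 <= r <= p + q ->
  bisector_sq p q r < bisector_sq p' q r.
Proof.
  intros Hp Hq Hr. unfold bisector_sq.
  assert (H1 : 0 <= r / (p' + q)) by (apply Rdiv_le_0_compat; lra).
  assert (H2 : r / (p' + q) < 1) by (apply Rlt_div_l; lra).
  assert (H3 : r / (p' + q) <= r / (p + q)).
  { apply Rmult_le_compat_l; [lra|]. apply Rinv_le_contravar; lra. }
  assert (H4 : (r / (p' + q)) ^ 2 <= (r / (p + q)) ^ 2) by nra.
  assert (H5 : (r / (p' + q)) ^ 2 < 1) by nra.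
  apply Rle_lt_trans with (p * q * (1 - (r / (p' + q)) ^ 2)).
  - apply Rmult_le_compat_l; nra.
  - apply Rmult_lt_compat_r; nra.
Qed.

(* Here [p + q - r] is kept fixed. *)
Lemma bisector_sq_shift_lt (p p' q r : R) :
  0 < p < p' -> 0 < q -> 0 <= r < p + q ->
  bisector_sq p q r < bisector_sq p' q (r + (p' - p)).
Proof.
  intros Hp Hq Hr. unfold bisector_sq.
  set (e := p + q - r).
  assert (He : 0 < e <= p + q) by (unfold e; lra).
  replace r with (p + q - e) by (unfold e; ring).
  (* This is the cofactor left when [q * e * (p' - p)] is taken out of the difference; it is
     positive because [e <= p + q]. *)
  assert (Hk : 0 < 2 * q * (p + q) * (p' + q) - e * (q * q - p * p')).
  { assert (0 < p * p') by nra.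
    assert (e * (q * q) <= (p + q) * (q * q)) by (apply Rmult_le_compat_r; nra).
    assert (0 <= e * (p * p')) by nra.
    assert (0 < q * (p + q)) by nra.
    nra. }
  apply Rlt_0_minus.
  replace (_ - _) with
    (q * e * (p' - p) * (2 * q * (p + q) * (p' + q) - e * (q * q - p * p'))
      / ((p + q) ^ 2 * (p' + q) ^ 2)) by (field; lra).
  apply Rdiv_lt_0_compat.
  - apply Rmult_lt_0_compat; [|exact Hk].
    apply Rmult_lt_0_compat; [nra|lra].
  - apply Rmult_lt_0_compat; apply pow_lt; lra.
Qed.

(** Go from [(b, c, a)] first to [(b', c, a + (b' - b))], then raise [c] to [c']. Neither move
    lowers the bisector, so only a third side at least [a + (b' - b)] can bring it back to its old
    value. *)
Lemma bisector_sq_opp_growth (b b' c c' a a' : R) :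
  0 < b <= b' -> 0 < c <= c' -> 0 <= a < b + c -> 0 <= a' ->
  bisector_sq b c a = bisector_sq b' c' a' ->
  b' - b <= a' - a /\ (b < b' \/ c < c' -> b' - b < a' - a).
Proof.
  intros Hb Hc Ha Ha' E.
  assert (H1 : bisector_sq b c a <= bisector_sq b' c (a + (b' - b)) /\
    (b < b' -> bisector_sq b c a < bisector_sq b' c (a + (b' - b)))).
  { destruct (Rle_lt_or_eq_dec b b' (proj2 Hb)) as [L|<-].
    - assert (H := bisector_sq_shift_lt b b' c a ltac:(lra) ltac:(lra) ltac:(lra)).
      lra.
    - replace (a + (b - b)) with a by ring. lra. }
  assert (H2 : bisector_sq b' c (a + (b' - b)) <= bisector_sq b' c' (a + (b' - b)) /\
    (c < c' -> bisector_sq b' c (a + (b' - b)) < bisector_sq b' c' (a + (b' - b)))).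
  { destruct (Rle_lt_or_eq_dec c c' (proj2 Hc)) as [L|<-]; [|lra].
    assert (H := bisector_sq_left_lt c c' b' (a + (b' - b))
      ltac:(lra) ltac:(lra) ltac:(lra)).
    rewrite (bisector_sqC c), (bisector_sqC c') in H. lra. }
  assert (H3 : a' < a + (b' - b) ->
    bisector_sq b' c' (a + (b' - b)) < bisector_sq b' c' a').
  { intros L. apply bisector_sq_opp_lt; lra. }
  assert (H4 : a' = a + (b' - b) ->
    bisector_sq b' c' (a + (b' - b)) = bisector_sq b' c' a') by (intros ->; reflexivity).
  split; [|intros H5]; destruct (Rtotal_order a' (a + (b' - b))) as [L|[L|L]]; lra.
Qed.

(* The hypotheses allow the degenerate case [c = a + b]. *)
Lemma two_bisectors_antitone (a b c a' b' c' : R) :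
  0 < a < b + c -> 0 < b < a + c -> 0 < c ->
  0 < a' -> b <= b' -> c <= c' ->
  bisector_sq b c a = bisector_sq b' c' a' ->
  bisector_sq a c b = bisector_sq a' c' b' ->
  a = a' /\ b = b' /\ c = c'.
Proof.
  intros Ha Hb Hc Ha' Lb Lc Ea Eb.
  assert (H1 := bisector_sq_opp_growth b b' c c' a a'
    ltac:(lra) ltac:(lra) ltac:(lra) ltac:(lra) Ea).
  (* [H1] supplies the [a <= a'] required here. The two growth bounds are opposite, so neither is
     strict and all sides agree. *)
  assert (H2 := bisector_sq_opp_growth a a' c c' b b'
    ltac:(lra) ltac:(lra) ltac:(lra) ltac:(lra) Eb).
  lra.
Qed.

(** * Monotonicity of the median along the solutions *)

Lemma median_bisector_gap (a b c l : R) :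
  0 < b -> 0 < c -> bisector_sq b c a = l ^ 2 ->
  2 * b ^ 2 + 2 * c ^ 2 - a ^ 2 = 4 * l ^ 2 + (b - c) ^ 2 * (1 + l ^ 2 / (b * c)).
Proof.
  intros Hb Hc <-. unfold bisector_sq. field. lra.
Qed.

(** The interval from [c'] to [b'] lies strictly inside that from [c] to [b], so both the difference
    and the ratio of its ends are smaller; and [(b - c)^2 / (b * c) = b/c + c/b - 2] increases with
    the ratio [b/c >= 1]. *)
Lemma gap_lt (b c b' c' k : R) :
  0 <= k -> 0 < b' < b -> 0 < c < c' -> c' <= b' ->
  (b' - c') ^ 2 * (1 + k / (b' * c')) < (b - c) ^ 2 * (1 + k / (b * c)).
Proof.
  intros Hk Hb Hc H.
  assert (H1 : (b' - c') ^ 2 < (b - c) ^ 2) by nra.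
  assert (H2 : (b' - c') ^ 2 / (b' * c') <= (b - c) ^ 2 / (b * c)).
  { apply Rminus_le_0.
    assert (0 < b' * c' /\ 0 < b * c) by nra.
    replace (_ - _) with
      ((b * c' - b' * c) * (b * b' - c * c') / (b * c * (b' * c'))) by (field; lra).
    apply Rlt_le, Rdiv_lt_0_compat; [|nra].
    apply Rmult_lt_0_compat; nra. }
  assert (H3 := Rmult_le_compat_l k _ _ Hk H2).
  unfold Rdiv in *. nra.
Qed.

Definition side_solution (l1 l2 a b c : R) : Prop :=
  0 < a < b + c /\ 0 < b < a + c /\ 0 < c < a + b /\
  bisector_sq b c a = l2 ^ 2 /\ bisector_sq a c b = l1 ^ 2.

Lemma side_solution_order (l1 l2 a b c a' b' c' : R) :
  side_solution l1 l2 a b c -> side_solution l1 l2 a' b' c' ->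
  (a = a' /\ b = b' /\ c = c') \/ (b' < b /\ c < c') \/ (b < b' /\ c' < c).
Proof.
  intros (A1 & A2 & A3 & A4 & A5) (B1 & B2 & B3 & B4 & B5).
  destruct (Rle_lt_dec b b') as [Lb|Lb]; destruct (Rle_lt_dec c c') as [Lc|Lc].
  - left. apply two_bisectors_antitone; lra.
  - destruct (Rle_lt_or_eq_dec b b' Lb) as [Lb'|Eb]; [lra|].
    assert (H := two_bisectors_antitone a' b' c' a b c). lra.
  - destruct (Rle_lt_or_eq_dec c c' Lc) as [Lc'|Ec]; [lra|].
    assert (H := two_bisectors_antitone a' b' c' a b c). lra.
  - assert (H := two_bisectors_antitone a' b' c' a b c). lra.
Qed.

Lemma side_solution_eq_of_median_side (l1 l2 a b c a' b' c' : R) :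
  side_solution l1 l2 a b c -> side_solution l1 l2 a' b' c' ->
  (c <= b /\ c' <= b') \/ (b <= c /\ b' <= c') ->
  2 * b ^ 2 + 2 * c ^ 2 - a ^ 2 = 2 * b' ^ 2 + 2 * c' ^ 2 - a' ^ 2 ->
  a = a' /\ b = b' /\ c = c'.
Proof.
  intros S S' Side Em.
  assert (Hk : 0 <= l2 ^ 2) by nra.
  destruct (side_solution_order _ _ _ _ _ _ _ _ S S') as [E|L]; [exact E|exfalso].
  destruct S as (A1 & A2 & A3 & A4 & _), S' as (B1 & B2 & B3 & B4 & _).
  rewrite (median_bisector_gap a b c l2), (median_bisector_gap a' b' c' l2) in Em by lra.
  (* [gap_lt] takes the larger side first, so the branch [b <= c] needs the expression with [b] and
     [c] exchanged. *)
  assert (Ew : (b - c) ^ 2 * (1 + l2 ^ 2 / (b * c))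
             = (c - b) ^ 2 * (1 + l2 ^ 2 / (c * b))) by (rewrite (Rmult_comm b c); ring).
  assert (Ew' : (b' - c') ^ 2 * (1 + l2 ^ 2 / (b' * c'))
             = (c' - b') ^ 2 * (1 + l2 ^ 2 / (c' * b'))) by (rewrite (Rmult_comm b' c'); ring).
  destruct Side as [Side|Side]; destruct L as [L|L].
  - assert (H := gap_lt b c b' c' (l2 ^ 2)). lra.
  - assert (H := gap_lt b' c' b c (l2 ^ 2)). lra.
  - assert (H := gap_lt c' b' c b (l2 ^ 2)). lra.
  - assert (H := gap_lt c b c' b' (l2 ^ 2)). lra.
Qed.

(** * The flat triangle a*, b*, c* and comparisons with it *)

Lemma bisector_sq_flat (p r : R) :
  0 < p -> 0 < r -> bisector_sq p (p + r) r = (2 * p * (p + r) / (p + (p + r))) ^ 2.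
Proof. intros Hp Hr. unfold bisector_sq. field. lra. Qed.

(** In a flat triangle with c = a + b each bisector is the harmonic mean of its adjacent sides,
    which expresses a and b through c as in the definitions of a* and b*. Then c = a + b becomes
    4c^2 - 4c(l1 + l2) + 3 l1 l2 = 0, whose larger root is c*. *)
Lemma star_spec (l1 l2 : R) :
  0 < l1 -> 0 < l2 ->
  let a := a_star l1 l2 in let b := b_star l1 l2 in let c := c_star l1 l2 in
  0 < a /\ 0 < b /\ c = a + b /\
  bisector_sq b c a = l2 ^ 2 /\ bisector_sq a c b = l1 ^ 2 /\
  l2 * (b + c) = 2 * b * c /\ ma_star l1 l2 = (b + c) / 2.
Proof.
  intros H1 H2 a b c.
  assert (Hq : 0 <= l1 ^ 2 + l2 ^ 2 - l1 * l2) by nra.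
  assert (Hs := sqrt_pos (l1 ^ 2 + l2 ^ 2 - l1 * l2)).
  assert (Hss := pow2_sqrt _ Hq).
  assert (Hc : 4 * c ^ 2 = 4 * c * (l1 + l2) - 3 * l1 * l2).
  { unfold c, c_star. set (s := sqrt _) in *. nra. }
  assert (Hc1 : l1 < 2 * c /\ l2 < 2 * c) by (unfold c, c_star; lra).
  assert (Ea : a = c * l1 / (2 * c - l1)) by (unfold a, a_star; fold c; field; lra).
  assert (Eb : b = c * l2 / (2 * c - l2)) by (unfold b, b_star; fold c; field; lra).
  assert (Ha : 0 < a) by (rewrite Ea; apply Rdiv_lt_0_compat; nra).
  assert (Hb : 0 < b) by (rewrite Eb; apply Rdiv_lt_0_compat; nra).
  assert (Ec : c = a + b).
  { assert (E : a + b - c = c * (4 * c * (l1 + l2) - 3 * l1 * l2 - 4 * c ^ 2)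
      / ((2 * c - l1) * (2 * c - l2))) by (rewrite Ea, Eb; field; lra).
    rewrite Hc in E. unfold Rdiv in E. nra. }
  assert (E2 : l2 = 2 * b * c / (b + c)).
  { rewrite Eb. field. split; [lra|]. apply Rgt_not_eq. nra. }
  assert (E1 : l1 = 2 * a * c / (a + c)).
  { rewrite Ea. field. split; [lra|]. apply Rgt_not_eq. nra. }
  repeat split; try assumption.
  - rewrite Ec, (Rplus_comm a b), bisector_sq_flat by assumption.
    rewrite E2, Ec, (Rplus_comm a b). reflexivity.
  - rewrite Ec, bisector_sq_flat by assumption. rewrite E1, Ec. reflexivity.
  - rewrite E2. field. lra.
  - unfold ma_star. fold a b. lra.
Qed.

(** [two_bisectors_antitone] leaves, besides the claim, only the case b <= b*, c > c*. There the
    flat triangle enlarged to side c has its l_b above l1, and the given triangle has a larger a and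
    a smaller b, so its l_b is larger still. *)
Lemma side_solution_lt_star (l1 l2 a b c : R) :
  0 < l1 -> 0 < l2 -> side_solution l1 l2 a b c ->
  b_star l1 l2 < b /\ c < c_star l1 l2.
Proof.
  intros H1 H2 (A1 & A2 & A3 & A4 & A5).
  destruct (star_spec l1 l2 H1 H2) as (B1 & B2 & B3 & B4 & B5 & _ & _).
  set (a0 := a_star l1 l2) in *. set (b0 := b_star l1 l2) in *.
  set (c0 := c_star l1 l2) in *.
  assert (D1 := two_bisectors_antitone a b c a0 b0 c0).
  assert (D2 := two_bisectors_antitone a0 b0 c0 a b c).
  destruct (Rle_lt_dec b b0) as [Lb|Lb]; [|lra]. exfalso.
  destruct (Rle_lt_dec c c0) as [Lc|Lc]; [lra|].
  (* Compare with the flat triangle rescaled to the same side [c]. *)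
  set (s := c / c0).
  assert (Hs : 1 < s) by (apply Rlt_div_r; lra).
  assert (Ec : s * c0 = c) by (unfold s; field; lra).
  assert (Hb : b < s * b0) by nra.
  assert (Ea : s * a0 = c - s * b0) by (rewrite <- Ec, B3; ring).
  assert (P1 : 0 < s * a0) by nra.
  assert (F1 : bisector_sq (s * a0) c (s * b0) = s ^ 2 * l1 ^ 2).
  { rewrite <- Ec, bisector_sq_scale, B5 by lra. reflexivity. }
  assert (F2 := bisector_sq_left_lt (s * a0) a c (s * b0)
    ltac:(lra) ltac:(lra) ltac:(nra)).
  assert (F3 := bisector_sq_opp_lt a c b (s * b0) ltac:(lra) ltac:(lra) ltac:(lra)).
  assert (0 < l1 ^ 2) by nra. assert (1 < s ^ 2) by nra. nra.
Qed.

Lemma side_solution_median_lt_star (l1 l2 a b c x : R) :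
  0 < l1 -> 0 < l2 -> side_solution l1 l2 a b c -> b < c ->
  4 * x ^ 2 = 2 * b ^ 2 + 2 * c ^ 2 - a ^ 2 -> x < ma_star l1 l2.
Proof.
  intros H1 H2 S Lbc Ex.
  destruct (side_solution_lt_star l1 l2 a b c H1 H2 S) as [Lb Lc].
  destruct S as (A1 & A2 & A3 & A4 & _).
  destruct (star_spec l1 l2 H1 H2) as (B1 & B2 & B3 & B4 & _ & _ & B7).
  rewrite B7.
  set (a0 := a_star l1 l2) in *. set (b0 := b_star l1 l2) in *.
  set (c0 := c_star l1 l2) in *.
  rewrite (median_bisector_gap a b c l2) in Ex by lra.
  (* As [a0 = c0 - b0], the left side here is [(b0 + c0)^2], that is 4 m_a*^2; and [b], [c] lie
     strictly between [b0] and [c0]. *)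
  assert (G := median_bisector_gap a0 b0 c0 l2 ltac:(lra) ltac:(lra) B4).
  assert (H := gap_lt c0 b0 c b (l2 ^ 2) ltac:(nra) ltac:(lra) ltac:(lra) ltac:(lra)).
  rewrite (Rmult_comm c0), (Rmult_comm c) in H.
  assert (4 * x ^ 2 < (b0 + c0) ^ 2) by nra.
  nra.
Qed.

(** * The family of triangles with given l_a and m_a *)

(* With P = bc, the difference b - c solves
   4(x^2 - l^2) = (b - c)^2 (1 + l^2/P), and [sg] is its sign; then
   (b + c)^2 = (b - c)^2 + 4P, and a is read off [bisector_sq b c a = l^2]. *)
Definition fam_diff (l x sg P : R) : R := sg * sqrt (4 * (x ^ 2 - l ^ 2) * (P / (P + l ^ 2))).
Definition fam_sum (l x P : R) : R := sqrt (4 * (x ^ 2 - l ^ 2) * (P / (P + l ^ 2)) + 4 * P).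
Definition fam_a (l x P : R) : R := fam_sum l x P * sqrt (1 - l ^ 2 / P).
Definition fam_b (l x sg P : R) : R := (fam_sum l x P + fam_diff l x sg P) / 2.
Definition fam_c (l x sg P : R) : R := (fam_sum l x P - fam_diff l x sg P) / 2.

(** The formula for [a ^ 2] explains the range of [P]: [a^2 - (b - c)^2] vanishes at [P = l * x] and
    is positive beyond, so the family starts at a degenerate triangle. *)
Lemma fam_spec (l x sg P : R) :
  0 < l <= x -> sg ^ 2 = 1 -> l * x <= P ->
  let a := fam_a l x P in let b := fam_b l x sg P in let c := fam_c l x sg P in
  0 < b /\ 0 < c /\ 0 <= a < b + c /\ b * c = P /\
  bisector_sq b c a = l ^ 2 /\ 2 * b ^ 2 + 2 * c ^ 2 - a ^ 2 = 4 * x ^ 2 /\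
  a ^ 2 = (b - c) ^ 2 + 4 * (P ^ 2 - (l * x) ^ 2) / (P + l ^ 2) /\
  0 <= sg * (b - c).
Proof.
  intros Hl Hsg HP a b c.
  assert (Hl2 : 0 < l ^ 2) by nra.
  assert (HlP : l ^ 2 <= P) by nra.
  assert (Hg : 0 <= 4 * (x ^ 2 - l ^ 2) * (P / (P + l ^ 2))).
  { apply Rmult_le_pos; [nra|]. apply Rdiv_le_0_compat; lra. }
  assert (Hr : 0 <= l ^ 2 / P <= 1).
  { split; [apply Rdiv_le_0_compat | apply Rle_div_l]; lra. }
  assert (Hr' : 0 < l ^ 2 / P) by (apply Rdiv_lt_0_compat; lra).
  set (d := fam_diff l x sg P) in *. set (s := fam_sum l x P).
  assert (Hd : d ^ 2 = 4 * (x ^ 2 - l ^ 2) * (P / (P + l ^ 2))).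
  { unfold d, fam_diff. rewrite Rpow_mult_distr, Hsg, pow2_sqrt by exact Hg. ring. }
  assert (Hs : s ^ 2 = d ^ 2 + 4 * P).
  { unfold s, fam_sum. rewrite pow2_sqrt by lra. rewrite Hd. reflexivity. }
  assert (Hs0 : 0 < s) by (unfold s, fam_sum; apply sqrt_lt_R0; lra).
  assert (Hbs : b + c = s) by (unfold b, c, fam_b, fam_c; fold d s; field).
  assert (Hbd : b - c = d) by (unfold b, c, fam_b, fam_c; fold d s; field).
  assert (Hbc : b * c = P).
  { replace (b * c) with (((b + c) ^ 2 - (b - c) ^ 2) / 4) by field.
    rewrite Hbs, Hbd, Hs. field. }
  assert (Hk := sqrt_pos (1 - l ^ 2 / P)).
  assert (Hk2 : sqrt (1 - l ^ 2 / P) ^ 2 = 1 - l ^ 2 / P) by (apply pow2_sqrt; lra).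
  assert (Ha2 : a ^ 2 = s ^ 2 * (1 - l ^ 2 / P)).
  { unfold a, fam_a. fold s. rewrite Rpow_mult_distr, Hk2. reflexivity. }
  assert (Hb : 0 < b) by nra.
  assert (Hc : 0 < c) by nra.
  assert (Hk1 : sqrt (1 - l ^ 2 / P) < 1) by nra.
  assert (Hbis : bisector_sq b c a = l ^ 2).
  { unfold bisector_sq. rewrite Hbc, Hbs.
    replace ((a / s) ^ 2) with (a ^ 2 / s ^ 2) by (field; lra).
    rewrite Ha2. field. lra. }
  repeat split; try assumption.
  - unfold a, fam_a. fold s. nra.
  - rewrite Hbs. unfold a, fam_a. fold s. nra.
  - rewrite (median_bisector_gap a b c l), Hbd, Hbc, Hd by assumption. field. lra.
  - rewrite Ha2, Hs, Hbd, Hd. field. lra.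
  - rewrite Hbd. unfold d, fam_diff. rewrite <- Rmult_assoc.
    replace (sg * sg) with 1 by lra. rewrite Rmult_1_l. apply sqrt_pos.
Qed.

Lemma fam_bisector_continuous (l x sg P : R) :
  0 < l <= x -> sg ^ 2 = 1 -> l * x <= P ->
  continuity_pt
    (fun P => bisector_sq (fam_a l x P) (fam_c l x sg P) (fam_b l x sg P)) P.
Proof.
  intros Hl Hsg HP.
  destruct (fam_spec l x sg P Hl Hsg HP) as (Hb & Hc & Ha & _).
  assert (Hl2 : 0 < l ^ 2) by nra.
  assert (HlP : l ^ 2 <= P) by nra.
  assert (HP0 : continuity_pt (fun P => P) P) by apply derivable_continuous_pt, derivable_pt_id.
  assert (Hcst : forall k, continuity_pt (fun _ => k) P)
    by (intros k; apply continuity_pt_const; intros ? ?; reflexivity).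
  assert (Hr : l ^ 2 / P <= 1) by (apply Rle_div_l; lra).
  assert (Hg : 0 <= 4 * (x ^ 2 - l ^ 2) * (P / (P + l ^ 2))).
  { apply Rmult_le_pos; [nra|]. apply Rdiv_le_0_compat; lra. }
  assert (Cg : continuity_pt (fun P => 4 * (x ^ 2 - l ^ 2) * (P / (P + l ^ 2))) P).
  { apply (continuity_pt_mult (fun _ => 4 * (x ^ 2 - l ^ 2)) (fun P => P / (P + l ^ 2)));
      [apply Hcst|].
    apply (continuity_pt_div (fun P => P) (fun P => P + l ^ 2)); [exact HP0| |lra].
    apply (continuity_pt_plus (fun P => P) (fun _ => l ^ 2)); auto. }
  (* [sqrt] is continuous at 0 as well, being 0 on the negative reals; this matters for [x = l],
     where both roots can vanish. *)
  assert (Csqrt : forall f, continuity_pt f P -> 0 <= f P ->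
    continuity_pt (fun P => sqrt (f P)) P).
  { intros f Cf Hf. apply (continuity_pt_comp f sqrt); [exact Cf|].
    apply continuity_pt_sqrt, Hf. }
  assert (Cs : continuity_pt (fam_sum l x) P).
  { apply (Csqrt (fun P => 4 * (x ^ 2 - l ^ 2) * (P / (P + l ^ 2)) + 4 * P)); [|lra].
    apply (continuity_pt_plus (fun P => _) (fun P => 4 * P)); [exact Cg|].
    apply (continuity_pt_mult (fun _ => 4) (fun P => P)); auto. }
  assert (Cd : continuity_pt (fam_diff l x sg) P).
  { apply (continuity_pt_mult (fun _ => sg) (fun P => sqrt (_))); [apply Hcst|].
    apply Csqrt; assumption. }
  assert (Ca : continuity_pt (fam_a l x) P).
  { apply (continuity_pt_mult (fam_sum l x) (fun P => sqrt (1 - l ^ 2 / P))); [exact Cs|].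
    apply (Csqrt (fun P => 1 - l ^ 2 / P)); [|lra].
    apply (continuity_pt_minus (fun _ => 1) (fun P => l ^ 2 / P)); [apply Hcst|].
    apply (continuity_pt_div (fun _ => l ^ 2) (fun P => P)); auto. lra. }
  assert (Cb : continuity_pt (fam_b l x sg) P).
  { apply (continuity_pt_div (fun P => fam_sum l x P + fam_diff l x sg P) (fun _ => 2)); auto.
    apply continuity_pt_plus; assumption. }
  assert (Cc : continuity_pt (fam_c l x sg) P).
  { apply (continuity_pt_div (fun P => fam_sum l x P - fam_diff l x sg P) (fun _ => 2)); auto.
    apply continuity_pt_minus; assumption. }
  unfold bisector_sq.
  apply (continuity_pt_mult (fun P => fam_a l x P * fam_c l x sg P)
    (fun P => 1 - (fam_b l x sg P / (fam_a l x P + fam_c l x sg P)) ^ 2)).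
  - apply continuity_pt_mult; assumption.
  - apply (continuity_pt_minus (fun _ => 1)
      (fun P => (fam_b l x sg P / (fam_a l x P + fam_c l x sg P)) ^ 2)); [apply Hcst|].
    apply (continuity_pt_comp (fun P => fam_b l x sg P / (fam_a l x P + fam_c l x sg P))
      (fun y => y ^ 2)).
    + apply continuity_pt_div; [exact Cb| |].
      * apply continuity_pt_plus; assumption.
      * unfold plus_fct. lra.
    + apply derivable_continuous_pt, derivable_pt_pow.
Qed.

(** [|b - c|] stays at most [2 * x], while [(b + c)^2 >= 4 * P]. The bound [16 * x ^ 2] makes
    [b + c >= 8 * x], hence [a], [c] and [a + c - b] are all at least [(b + c) / 4], and l_b^2 is at
    least [(b + c)^2 / 32]. *)
Lemma fam_bisector_large (l x sg P : R) :
  0 < l <= x -> sg ^ 2 = 1 -> 16 * x ^ 2 <= P ->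
  P / 8 <= bisector_sq (fam_a l x P) (fam_c l x sg P) (fam_b l x sg P).
Proof.
  intros Hl Hsg HP.
  assert (HlP : l * x <= P) by nra.
  destruct (fam_spec l x sg P Hl Hsg HlP) as (Hb & Hc & Ha & HPbc & Hbis & Hm & Hd & Hside).
  set (a := fam_a l x P) in *. set (b := fam_b l x sg P) in *. set (c := fam_c l x sg P) in *.
  assert (Hgap := median_bisector_gap a b c l Hb Hc Hbis).
  assert (Hq : 0 <= l ^ 2 / (b * c)) by (apply Rdiv_le_0_compat; nra).
  assert (Hbc2 : (b - c) ^ 2 <= 4 * x ^ 2) by nra.
  assert (Hbc1 : - (2 * x) <= b - c <= 2 * x) by nra.
  assert (Hs2 : (8 * x) ^ 2 <= (b + c) ^ 2).
  { assert (0 <= (b - c) ^ 2) by apply pow2_ge_0. nra. }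
  assert (Hs : 8 * x <= b + c) by nra.
  assert (Ha2 : (b + c) / 2 <= a).
  { assert (4 * x ^ 2 = (b + c) ^ 2 + (b - c) ^ 2 - a ^ 2) by lra.
    assert (64 * x ^ 2 <= (b + c) ^ 2) by nra. nra. }
  assert (Hc4 : (b + c) / 4 <= c) by lra.
  assert (Hacb : (b + c) / 4 <= a + c - b) by lra.
  apply Rle_trans with ((b + c) ^ 2 / 32); [nra|].
  unfold bisector_sq.
  replace (a * c * (1 - (b / (a + c)) ^ 2)) with
    (a * c * ((a + c - b) * (a + c + b)) / (a + c) ^ 2) by (field; lra).
  apply (Rle_div_r _ _ ((a + c) ^ 2)); [apply pow_lt; lra|].
  assert (F1 : (b + c) / 4 * (a + c) <= (a + c - b) * (a + c + b)).
  { apply Rmult_le_compat; lra. }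
  assert (F2 : (b + c) / 8 * (a + c) <= a * c).
  { assert (0 <= (a - (b + c) / 4) * (c - (b + c) / 4)) by (apply Rmult_le_pos; lra).
    nra. }
  replace ((b + c) ^ 2 / 32 * (a + c) ^ 2) with
    ((b + c) / 8 * (a + c) * ((b + c) / 4 * (a + c))) by field.
  apply Rmult_le_compat; nra.
Qed.

(** Existence reduces to the degenerate end [P = l2 * x]: if l_b is below [l1] there, it passes [l1]
    before [P1], and at a later [P] than the end, where the triangle is nondegenerate. *)
Lemma side_solution_of_flat_lt (l1 l2 x sg : R) :
  0 < l1 -> 0 < l2 <= x -> sg ^ 2 = 1 ->
  bisector_sq (fam_a l2 x (l2 * x)) (fam_c l2 x sg (l2 * x)) (fam_b l2 x sg (l2 * x))
    < l1 ^ 2 ->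
  exists a b c, side_solution l1 l2 a b c /\
    2 * b ^ 2 + 2 * c ^ 2 - a ^ 2 = 4 * x ^ 2 /\ 0 <= sg * (b - c).
Proof.
  intros H1 Hl Hsg H0.
  set (h := fun P => bisector_sq (fam_a l2 x P) (fam_c l2 x sg P) (fam_b l2 x sg P) - l1 ^ 2).
  set (P1 := 16 * x ^ 2 + 8 * l1 ^ 2 + 1).
  destruct (IVT_interv h (l2 * x) P1) as (P & HP & E).
  - intros P HP.
    apply (continuity_pt_minus _ (fun _ => l1 ^ 2)).
    + apply fam_bisector_continuous; lra.
    + apply continuity_pt_const. intros ? ?. reflexivity.
  - unfold P1. nra.
  - unfold h. lra.
  - assert (H := fam_bisector_large l2 x sg P1 Hl Hsg). unfold h, P1 in *. nra.
  - assert (HPlt : l2 * x < P).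
    { destruct (Rle_lt_or_eq_dec _ _ (proj1 HP)) as [L|L]; [exact L|].
      rewrite <- L in E. unfold h in E. lra. }
    destruct (fam_spec l2 x sg P Hl Hsg (proj1 HP))
      as (Hb & Hc & Ha & HPbc & Hbis & Hm & Hd & Hside).
    unfold h in E.
    set (a := fam_a l2 x P) in *. set (b := fam_b l2 x sg P) in *.
    set (c := fam_c l2 x sg P) in *.
    assert (Hgt : (b - c) ^ 2 < a ^ 2).
    { assert (0 < 4 * (P ^ 2 - (l2 * x) ^ 2) / (P + l2 ^ 2)).
      { apply Rdiv_lt_0_compat; [|nra].
        replace (4 * (P ^ 2 - (l2 * x) ^ 2)) with (4 * ((P - l2 * x) * (P + l2 * x))) by ring.
        assert (0 < l2 * x) by (apply Rmult_lt_0_compat; lra).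
        apply Rmult_lt_0_compat; [lra|]. apply Rmult_lt_0_compat; lra. }
      lra. }
    exists a, b, c. split; [|split; assumption].
    assert (Hda : - a < b - c < a) by nra.
    unfold side_solution. repeat split; lra.
Qed.

(** On the branch c <= b the degenerate end has b = a + c, where l_b is 0. *)
Lemma side_solution_exists_tall (l1 l2 x : R) :
  0 < l1 -> 0 < l2 <= x ->
  exists a b c, side_solution l1 l2 a b c /\
    2 * b ^ 2 + 2 * c ^ 2 - a ^ 2 = 4 * x ^ 2 /\ c <= b.
Proof.
  intros H1 Hl.
  destruct (side_solution_of_flat_lt l1 l2 x 1) as (a & b & c & S & M & L);
    [exact H1|exact Hl|ring| |exists a, b, c; repeat split; try apply S; lra].
  destruct (fam_spec l2 x 1 (l2 * x) Hl ltac:(ring) ltac:(lra))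
    as (Hb & Hc & Ha & _ & _ & _ & Hd & Hside).
  set (a := fam_a _ _ _) in *. set (b := fam_b _ _ _ _) in *. set (c := fam_c _ _ _ _) in *.
  assert (Eb : b = a + c).
  { unfold Rdiv in Hd. ring_simplify in Hd. nra. }
  unfold bisector_sq. rewrite Eb, Rdiv_diag by lra. nra.
Qed.

(** On the branch b <= c the end is flat with c = a + b, like a*, b*, c*. Its smaller median means a
    smaller c/b. Scaled by s to the same c, the starred triangle has the smaller b and the larger a;
    comparing l_a gives s < 1, and comparing l_b then gives l_b < s l1 < l1. *)
Lemma side_solution_exists_flat (l1 l2 x : R) :
  0 < l1 -> 0 < l2 <= x -> x < ma_star l1 l2 ->
  exists a b c, side_solution l1 l2 a b c /\
    2 * b ^ 2 + 2 * c ^ 2 - a ^ 2 = 4 * x ^ 2 /\ b <= c.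
Proof.
  intros H1 Hl Hx.
  destruct (side_solution_of_flat_lt l1 l2 x (-1)) as (a & b & c & S & M & L);
    [exact H1|exact Hl|ring| |exists a, b, c; repeat split; try apply S; lra].
  destruct (fam_spec l2 x (-1) (l2 * x) Hl ltac:(ring) ltac:(lra))
    as (Hb & Hc & Ha & HP & Hbis & Hm & Hd & Hside).
  set (a := fam_a _ _ _) in *. set (b := fam_b _ _ _ _) in *. set (c := fam_c _ _ _ _) in *.
  assert (Ec : c = a + b).
  { unfold Rdiv in Hd. ring_simplify in Hd. nra. }
  assert (Es : b + c = 2 * x).
  { apply Rsqr_inj; [lra|lra|]. unfold Rsqr. nra. }
  destruct (star_spec l1 l2 H1 ltac:(lra)) as (B1 & B2 & B3 & B4 & B5 & B6 & B7).
  set (a0 := a_star l1 l2) in *. set (b0 := b_star l1 l2) in *.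
  set (c0 := c_star l1 l2) in *.
  (* Since [(b + c)^2 / (b * c) = 4 * x / l2], and likewise 4 m_a* / l2 for [b0], [c0], the ratio
     [c / b] is the one closer to 1. *)
  assert (Hratio : b0 * c < b * c0).
  { assert (H : (b + c) ^ 2 * (b0 * c0) < (b0 + c0) ^ 2 * (b * c)).
    { replace (b0 * c0) with (l2 * (b0 + c0) / 2) by lra.
      rewrite HP, Es.
      assert (0 < l2 * x * (b0 + c0)) by (apply Rmult_lt_0_compat; nra).
      nra. }
    assert (H' : 0 < (b * c0 - b0 * c) * (c * c0 - b * b0)) by lra.
    assert (0 < c * c0 - b * b0) by nra. nra. }
  set (s := c / c0).
  assert (Hs : 0 < s) by (apply Rdiv_lt_0_compat; lra).
  assert (Esc : s * c0 = c) by (unfold s; field; lra).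
  assert (Hsb : s * b0 < b).
  { apply Rmult_lt_reg_r with c0; [lra|]. nra. }
  assert (Esa : s * a0 = c - s * b0) by (rewrite <- Esc, B3; ring).
  assert (Hsb0 : 0 < s * b0) by nra.
  assert (F1 : bisector_sq (s * b0) c (s * a0) = s ^ 2 * l2 ^ 2).
  { rewrite <- Esc, bisector_sq_scale, B4 by lra. reflexivity. }
  assert (F2 : bisector_sq (s * a0) c (s * b0) = s ^ 2 * l1 ^ 2).
  { rewrite <- Esc, bisector_sq_scale, B5 by lra. reflexivity. }
  assert (G1 := bisector_sq_left_lt (s * b0) b c (s * a0) ltac:(lra) ltac:(lra) ltac:(lra)).
  assert (G2 := bisector_sq_opp_lt b c a (s * a0) ltac:(lra) ltac:(lra) ltac:(lra)).
  assert (Hs1 : s ^ 2 < 1) by nra.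
  destruct (Rle_lt_or_eq_dec 0 a (proj1 Ha)) as [Ha0|Ha0].
  - assert (G3 := bisector_sq_left_lt a (s * a0) c (s * b0) ltac:(lra) ltac:(lra) ltac:(lra)).
    assert (G4 := bisector_sq_opp_lt a c (s * b0) b ltac:(lra) ltac:(lra) ltac:(lra)).
    nra.
  (* [a = 0] is the case [x = l2]. *)
  - unfold bisector_sq. rewrite <- Ha0. nra.
Qed.

(** * From triangles to side lengths *)

Definition cross (P Q S : point) : R :=
  (fst Q - fst P) * (snd S - snd P) - (snd Q - snd P) * (fst S - fst P).

Definition dot (O P Q : point) : R :=
  (fst P - fst O) * (fst Q - fst O) + (snd P - snd O) * (snd Q - snd O).

Lemma collinear_iff_cross0 (P Q S : point) : collinear P Q S <-> cross P Q S = 0.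
Proof.
  destruct P as [p1 p2], Q as [q1 q2], S as [s1 s2]; unfold cross; simpl. split.
  - intros (u & v & w & Huv & E1 & E2 & E3). simpl in *.
    assert (F1 : u * (q1 - p1) + v * (q2 - p2) = 0) by lra.
    assert (F2 : u * (s1 - p1) + v * (s2 - p2) = 0) by lra.
    set (X := _ - _).
    (* Cramer's rule: [X] is the determinant of the system [F1], [F2] in [u], [v]. *)
    assert (u * X = 0 /\ v * X = 0) as [G1 G2].
    { unfold X. split.
      - replace (_ * _) with ((u * (q1 - p1) + v * (q2 - p2)) * (s2 - p2)
          - (u * (s1 - p1) + v * (s2 - p2)) * (q2 - p2)) by ring.
        rewrite F1, F2. ring.
      - replace (_ * _) with ((u * (s1 - p1) + v * (s2 - p2)) * (q1 - p1)
          - (u * (q1 - p1) + v * (q2 - p2)) * (s1 - p1)) by ring.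
        rewrite F1, F2. ring. }
    apply Rmult_integral in G1, G2. tauto.
  - intros E.
    destruct (Req_dec q1 p1) as [E1|E1]; [destruct (Req_dec q2 p2) as [E2|E2]|].
    + subst. destruct (Req_dec s1 p1) as [E1|E1].
      * exists 1, 0, p1. simpl. lra.
      * exists (s2 - p2), (p1 - s1), ((s2 - p2) * p1 + (p1 - s1) * p2). simpl.
        split; [lra|]. repeat split; ring.
    + exists (q2 - p2), (p1 - q1), ((q2 - p2) * p1 + (p1 - q1) * p2). simpl.
      split; [lra|]. repeat split; try ring; lra.
    + exists (q2 - p2), (p1 - q1), ((q2 - p2) * p1 + (p1 - q1) * p2). simpl.
      split; [lra|]. repeat split; try ring; lra.
Qed.

Lemma pdist_sqr (P Q : point) :
  pdist P Q ^ 2 = (fst P - fst Q) ^ 2 + (snd P - snd Q) ^ 2.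
Proof.
  unfold pdist, dist_euc. rewrite pow2_sqrt, !Rsqr_pow2; [reflexivity|].
  apply Rplus_le_le_0_compat; apply Rle_0_sqr.
Qed.

Lemma pdist_ge0 (P Q : point) : 0 <= pdist P Q.
Proof. apply sqrt_pos. Qed.

Lemma pdistC (P Q : point) : pdist P Q = pdist Q P.
Proof. apply distance_symm. Qed.

Lemma sqr_inj_nonneg (x y : R) : 0 <= x -> 0 <= y -> x ^ 2 = y ^ 2 -> x = y.
Proof. intros Hx Hy E. nra. Qed.

Lemma pdist_eq (P Q : point) (l : R) :
  0 <= l -> (fst P - fst Q) ^ 2 + (snd P - snd Q) ^ 2 = l ^ 2 -> pdist P Q = l.
Proof.
  intros Hl E. apply sqr_inj_nonneg; [apply pdist_ge0|exact Hl|].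
  rewrite pdist_sqr. exact E.
Qed.

Lemma pdist_gt0 (P Q : point) :
  fst P <> fst Q \/ snd P <> snd Q -> 0 < pdist P Q.
Proof.
  intros H. assert (H0 := pdist_ge0 P Q). assert (E := pdist_sqr P Q).
  destruct (Rle_lt_or_eq_dec _ _ H0) as [L|L]; [exact L|].
  rewrite <- L, pow_i, <- !Rsqr_pow2 in E by auto.
  destruct (Rplus_sqr_eq_0 _ _ (eq_sym E)). exfalso. lra.
Qed.

Lemma dot_sqr_cross_sqr (P Q S : point) :
  dot P Q S ^ 2 + cross P Q S ^ 2 = (pdist P Q * pdist P S) ^ 2.
Proof. rewrite Rpow_mult_distr, !pdist_sqr. unfold dot, cross. ring. Qed.

Lemma dot_law_of_cosines (P Q S : point) :
  2 * dot P Q S = pdist P Q ^ 2 + pdist P S ^ 2 - pdist Q S ^ 2.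
Proof. rewrite !pdist_sqr. unfold dot. ring. Qed.

Lemma cross_neq0_pdist (P Q S : point) :
  cross P Q S <> 0 -> 0 < pdist P Q /\ 0 < pdist P S /\ 0 < pdist Q S.
Proof.
  unfold cross. intros H. repeat split; apply pdist_gt0.
  - destruct (Req_dec (fst P) (fst Q)) as [E|E]; [right|tauto].
    intros E'. apply H. rewrite E, E'. ring.
  - destruct (Req_dec (fst P) (fst S)) as [E|E]; [right|tauto].
    intros E'. apply H. rewrite E, E'. ring.
  - destruct (Req_dec (fst Q) (fst S)) as [E|E]; [right|tauto].
    intros E'. apply H. rewrite E, E'. ring.
Qed.

Lemma cross_neq0_dot (P Q S : point) :
  cross P Q S <> 0 -> - (pdist P Q * pdist P S) < dot P Q S < pdist P Q * pdist P S.
Proof.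
  intros H. destruct (cross_neq0_pdist P Q S H) as (H1 & H2 & _).
  assert (E := dot_sqr_cross_sqr P Q S).
  assert (0 < cross P Q S ^ 2) by (apply pow2_gt_0; exact H).
  assert (0 < pdist P Q * pdist P S) by nra. nra.
Qed.

Lemma triangle_strict (P Q S : point) :
  cross P Q S <> 0 ->
  pdist Q S < pdist P Q + pdist P S /\ pdist P Q < pdist Q S + pdist P S /\
  pdist P S < pdist Q S + pdist P Q.
Proof.
  intros H. destruct (cross_neq0_pdist P Q S H) as (H1 & H2 & H3).
  assert (H4 := cross_neq0_dot P Q S H). assert (H5 := dot_law_of_cosines P Q S).
  repeat split; nra.
Qed.

(** * Bisector lengths in terms of the sides *)

Lemma cosine_bounds (O P Q : point) :
  0 < pdist O P -> 0 < pdist O Q ->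
  -1 <= dot O P Q / (pdist O P * pdist O Q) <= 1.
Proof.
  intros H1 H2.
  assert (E := dot_sqr_cross_sqr O P Q).
  assert (0 < pdist O P * pdist O Q) by nra.
  split; [apply Rle_div_r | apply Rle_div_l]; nra.
Qed.

Lemma angle_eq_iff (P Q D S : point) :
  0 < pdist P Q -> 0 < pdist P D -> 0 < pdist P S ->
  angle Q P D = angle D P S <->
  dot P Q D * pdist P S = dot P D S * pdist P Q.
Proof.
  intros HQ HD HS.
  change (acos (dot P Q D / (pdist P Q * pdist P D))
          = acos (dot P D S / (pdist P D * pdist P S)) <->
    dot P Q D * pdist P S = dot P D S * pdist P Q).
  assert (B1 := cosine_bounds P Q D HQ HD). assert (B2 := cosine_bounds P D S HD HS).
  split; intros E.
  - apply (f_equal cos) in E. rewrite !cos_acos in E by assumption.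
    replace (dot P Q D * pdist P S) with
      (dot P Q D / (pdist P Q * pdist P D) * (pdist P Q * pdist P D * pdist P S))
      by (field; lra).
    rewrite E. field. lra.
  - f_equal.
    replace (dot P Q D / (pdist P Q * pdist P D)) with
      (dot P Q D * pdist P S / (pdist P Q * pdist P D * pdist P S)) by (field; lra).
    rewrite E. field. lra.
Qed.

(** For a point dividing QS in the parameter [t], equality of the angles reads
    [(q * s - w) * ((1 - t) * q - t * s) = 0]. The first factor is positive by strict
    Cauchy-Schwarz, so [t = q / (q + s)], and Stewart's theorem gives the length. *)
Lemma bisector_length_iff (P Q S : point) (l : R) :
  cross P Q S <> 0 -> 0 < l ->
  bisector_length P Q S l <->
  bisector_sq (pdist P Q) (pdist P S) (pdist Q S) = l ^ 2.
Proof.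
  intros HX Hl.
  destruct (cross_neq0_pdist P Q S HX) as (HQ & HS & HQS).
  assert (HW := cross_neq0_dot P Q S HX).
  assert (HL := dot_law_of_cosines P Q S).
  assert (HQ2 : dot P Q Q = pdist P Q ^ 2) by (rewrite pdist_sqr; unfold dot; ring).
  assert (HS2 : dot P S S = pdist P S ^ 2) by (rewrite pdist_sqr; unfold dot; ring).
  set (q := pdist P Q) in *. set (s := pdist P S) in *. set (r := pdist Q S) in *.
  set (w := dot P Q S) in *.
  set (pt := fun t : R => ((1 - t) * fst Q + t * fst S, (1 - t) * snd Q + t * snd S)).
  assert (HD : forall t, pdist P (pt t) ^ 2 =
    (1 - t) ^ 2 * q ^ 2 + 2 * t * (1 - t) * w + t ^ 2 * s ^ 2).
  { intros t. rewrite pdist_sqr. unfold w. rewrite <- HQ2, <- HS2.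
    unfold dot, pt. simpl. ring. }
  assert (HDpos : forall t, 0 < pdist P (pt t)).
  { intros t. apply pdist_gt0.
    destruct (Req_dec (fst P) (fst (pt t))) as [E1|E1]; [|tauto].
    right. intros E2. apply HX. unfold cross, pt in *. simpl in *.
    rewrite E1, E2. ring. }
  assert (HA : forall t, angle Q P (pt t) = angle (pt t) P S <-> (1 - t) * q = t * s).
  { intros t. rewrite angle_eq_iff by auto. fold q s.
    replace (dot P Q (pt t)) with ((1 - t) * q ^ 2 + t * w)
      by (rewrite <- HQ2; unfold w, dot, pt; simpl; ring).
    replace (dot P (pt t) S) with ((1 - t) * w + t * s ^ 2)
      by (rewrite <- HS2; unfold w, dot, pt; simpl; ring).
    split; intros E.
    - assert (F : (q * s - w) * ((1 - t) * q - t * s) = 0) by nra.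
      destruct (Rmult_integral _ _ F); lra.
    - apply Rminus_diag_uniq.
      replace (_ - _) with ((q * s - w) * ((1 - t) * q - t * s)) by ring.
      rewrite E. ring. }
  set (t0 := q / (q + s)).
  assert (Ht0 : forall t, (1 - t) * q = t * s -> t = t0).
  { intros t E. unfold t0. apply (Rmult_eq_reg_r (q + s)); [|lra].
    unfold Rdiv. rewrite Rmult_assoc, Rinv_l by lra. lra. }
  assert (Ht0' : (1 - t0) * q = t0 * s) by (unfold t0; field; lra).
  assert (HB : pdist P (pt t0) ^ 2 = bisector_sq q s r).
  { rewrite HD. unfold bisector_sq, t0.
    replace w with ((q ^ 2 + s ^ 2 - r ^ 2) / 2) by lra. field. lra. }
  split.
  - intros (D & (t & Ht & ->) & Ang & <-).
    rewrite <- HB. apply HA, Ht0 in Ang. rewrite <- Ang. reflexivity.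
  - intros E. exists (pt t0). split; [|split].
    + exists t0. split; [|reflexivity]. unfold t0.
      split; [apply Rdiv_le_0_compat | apply Rle_div_l]; lra.
    + apply HA, Ht0'.
    + apply sqr_inj_nonneg; [apply pdist_ge0|lra|]. lra.
Qed.

(** * Congruence and side lengths *)

Definition same_sides (T T' : plane_triangle) : Prop :=
  pdist (vB T) (vC T) = pdist (vB T') (vC T') /\
  pdist (vA T) (vC T) = pdist (vA T') (vC T') /\
  pdist (vA T) (vB T) = pdist (vA T') (vB T').

Lemma triangle_cross_neq0 (T : plane_triangle) : cross (vA T) (vB T) (vC T) <> 0.
Proof. intros H. apply (nondegenerate T), collinear_iff_cross0, H. Qed.

Lemma congruent_same_sides (T T' : plane_triangle) : congruent T T' -> same_sides T T'.
Proof.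
  intros (f & Hf & EA & EB & EC).
  unfold same_sides. rewrite <- EA, <- EB, <- EC, !Hf. auto.
Qed.

(* In the frame formed by AB and AB turned by a right angle, C has coordinates
   dot/|AB|^2 and cross/|AB|^2; equal sides force these to agree up to the sign
   [sg] of the second one. *)
Lemma same_sides_congruent (T T' : plane_triangle) : same_sides T T' -> congruent T T'.
Proof.
  intros (Ea & Eb & Ec).
  assert (HX := triangle_cross_neq0 T).
  assert (HD : dot (vA T) (vB T) (vC T) = dot (vA T') (vB T') (vC T')).
  { assert (H := dot_law_of_cosines (vA T) (vB T) (vC T)).
    rewrite Ea, Eb, Ec, <- dot_law_of_cosines in H. lra. }
  assert (HC : cross (vA T) (vB T) (vC T) ^ 2 = cross (vA T') (vB T') (vC T') ^ 2).
  { assert (H := dot_sqr_cross_sqr (vA T) (vB T) (vC T)).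
    rewrite HD, Eb, Ec, <- dot_sqr_cross_sqr in H. lra. }
  assert (Hc : 0 < pdist (vA T) (vB T)) by apply (cross_neq0_pdist _ _ _ HX).
  assert (Hc2 : 0 < pdist (vA T) (vB T) ^ 2) by (apply pow_lt; exact Hc).
  assert (Ec2 : pdist (vA T) (vB T) ^ 2 = pdist (vA T') (vB T') ^ 2) by (rewrite Ec; reflexivity).
  rewrite !pdist_sqr in Ec2. rewrite pdist_sqr in Hc2.
  destruct T as [[a1 a2] [b1 b2] [c1 c2] HT], T' as [[a1' a2'] [b1' b2'] [c1' c2'] HT'].
  clear Ea Eb Ec Hc. unfold congruent, cross, dot in *. cbn [vA vB vC fst snd] in *.
  set (k := (b1 - a1) * (c2 - a2) - (b2 - a2) * (c1 - a1)) in *.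
  set (k' := (b1' - a1') * (c2' - a2') - (b2' - a2') * (c1' - a1')) in *.
  set (n := (a1 - b1) ^ 2 + (a2 - b2) ^ 2) in *.
  set (sg := k' / k).
  assert (Hsg : sg ^ 2 = 1).
  { unfold sg. replace ((k' / k) ^ 2) with (k' ^ 2 / k ^ 2) by (field; exact HX).
    rewrite <- HC. field. exact HX. }
  assert (Hsgk : sg * k = k') by (unfold sg; field; exact HX).
  set (u := fun P : point => ((b1 - a1) * (fst P - a1) + (b2 - a2) * (snd P - a2)) / n).
  set (v := fun P : point => sg * ((b1 - a1) * (snd P - a2) - (b2 - a2) * (fst P - a1)) / n).
  exists (fun P => (a1' + u P * (b1' - a1') - v P * (b2' - a2'),
                    a2' + u P * (b2' - a2') + v P * (b1' - a1'))).
  split; [|split; [|split]].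
  - intros P Q. apply pdist_eq; [apply pdist_ge0|]. rewrite pdist_sqr. cbn [fst snd].
    set (du := u P - u Q). set (dv := v P - v Q).
    (* The target frame is orthogonal with both axes of length |A'B'|, and |A'B'|^2 = [n]. *)
    replace (_ + _) with ((du ^ 2 + dv ^ 2) * ((a1' - b1') ^ 2 + (a2' - b2') ^ 2))
      by (unfold du, dv; ring).
    rewrite <- Ec2.
    replace (dv ^ 2) with (sg ^ 2 * (((b1 - a1) * (snd P - snd Q)
      - (b2 - a2) * (fst P - fst Q)) / n) ^ 2) by (unfold dv, v; field; lra).
    rewrite Hsg. unfold du, u, n. field. fold n. lra.
  - unfold u, v. cbn [fst snd]. f_equal; field; lra.
  - assert (Eu : u (b1, b2) = 1) by (unfold u; cbn [fst snd]; unfold n; field; fold n; lra).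
    assert (Ev : v (b1, b2) = 0) by (unfold v; cbn [fst snd]; field; lra).
    rewrite Eu, Ev. f_equal; ring.
  - unfold u, v. cbn [fst snd]. fold k. rewrite HD, Hsgk, Ec2. unfold k'.
    assert ((a1' - b1') ^ 2 + (a2' - b2') ^ 2 <> 0) by (rewrite <- Ec2; lra).
    f_equal; field; assumption.
Qed.

Lemma triangle_of_sides (a b c : R) :
  0 < a < b + c -> 0 < b < a + c -> 0 < c < a + b ->
  exists T : plane_triangle, pdist (vB T) (vC T) = a /\
    pdist (vA T) (vC T) = b /\ pdist (vA T) (vB T) = c.
Proof.
  intros Ha Hb Hc.
  set (u := (b ^ 2 + c ^ 2 - a ^ 2) / (2 * c)).
  (* With A at the origin and B at [(c, 0)], C has abscissa [u] by the law of cosines; the square of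
     its height is positive by Heron's formula. *)
  assert (Hv : 0 < b ^ 2 - u ^ 2).
  { replace (b ^ 2 - u ^ 2) with
      ((a - b + c) * (a + b - c) * ((b + c - a) * (a + b + c)) / (2 * c) ^ 2)
      by (unfold u; field; lra).
    apply Rdiv_lt_0_compat; [|apply pow_lt; lra].
    repeat apply Rmult_lt_0_compat; lra. }
  set (v := sqrt (b ^ 2 - u ^ 2)).
  assert (Hv0 : 0 < v) by (apply sqrt_lt_R0; exact Hv).
  assert (Hv2 : v ^ 2 = b ^ 2 - u ^ 2) by (apply pow2_sqrt; lra).
  assert (ND : ~ collinear (0, 0) (c, 0) (u, v)).
  { rewrite collinear_iff_cross0. unfold cross. cbn [fst snd]. nra. }
  exists (PlaneTriangle _ _ _ ND). cbn [vA vB vC].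
  repeat split; apply pdist_eq; try lra; cbn [fst snd].
  - replace ((c - u) ^ 2 + (0 - v) ^ 2) with (c ^ 2 - 2 * c * u + u ^ 2 + v ^ 2) by ring.
    rewrite Hv2. unfold u. field. lra.
  - replace ((0 - u) ^ 2 + (0 - v) ^ 2) with (u ^ 2 + v ^ 2) by ring. lra.
  - ring.
Qed.

(** * Counting the triangles *)

Lemma ma_sqr (T : plane_triangle) :
  4 * ma T ^ 2 = 2 * pdist (vA T) (vC T) ^ 2 + 2 * pdist (vA T) (vB T) ^ 2
                 - pdist (vB T) (vC T) ^ 2.
Proof. unfold ma, midpoint. rewrite !pdist_sqr. cbn [fst snd]. field. Qed.

Lemma solution_iff (l1 l2 x : R) (T : plane_triangle) :
  0 < l1 -> 0 < l2 ->
  let a := pdist (vB T) (vC T) in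
  let b := pdist (vA T) (vC T) in
  let c := pdist (vA T) (vB T) in
  solution l1 l2 x T <->
  side_solution l1 l2 a b c /\ 0 <= x /\ 2 * b ^ 2 + 2 * c ^ 2 - a ^ 2 = 4 * x ^ 2.
Proof.
  intros H1 H2 a b c.
  assert (HX := triangle_cross_neq0 T).
  assert (HX' : cross (vB T) (vC T) (vA T) <> 0).
  { intros E. apply HX. rewrite <- E. unfold cross. ring. }
  destruct (cross_neq0_pdist _ _ _ HX) as (Hc & Hb & Ha).
  destruct (triangle_strict _ _ _ HX) as (Ta & Tc & Tb).
  unfold solution, is_la, is_lb, side_solution.
  rewrite !bisector_length_iff by assumption.
  rewrite (pdistC (vB T) (vA T)), (pdistC (vC T) (vA T)).
  fold a b c in Ha, Hb, Hc, Ta, Tb, Tc |- *.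
  rewrite (bisector_sqC c b).
  assert (Hm := ma_sqr T). fold a b c in Hm.
  assert (Hm0 : 0 <= ma T) by apply pdist_ge0.
  split.
  - intros (E2 & E1 & <-). repeat split; lra.
  - intros ((_ & _ & _ & E2 & E1) & Hx & Em). repeat split; try assumption.
    apply sqr_inj_nonneg; lra.
Qed.

Lemma solution_of_sides (l1 l2 x a b c : R) :
  0 < l1 -> 0 < l2 -> 0 <= x -> side_solution l1 l2 a b c ->
  2 * b ^ 2 + 2 * c ^ 2 - a ^ 2 = 4 * x ^ 2 ->
  exists T, solution l1 l2 x T /\ pdist (vB T) (vC T) = a /\
    pdist (vA T) (vC T) = b /\ pdist (vA T) (vB T) = c.
Proof.
  intros H1 H2 Hx S Em.
  destruct (triangle_of_sides a b c) as (T & Ea & Eb & Ec); try apply S.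
  exists T. split; [|auto].
  apply solution_iff; try assumption. rewrite Ea, Eb, Ec. auto.
Qed.

Lemma solutions_congruent (l1 l2 x : R) (T T' : plane_triangle) :
  0 < l1 -> 0 < l2 -> solution l1 l2 x T -> solution l1 l2 x T' ->
  let b := pdist (vA T) (vC T) in let c := pdist (vA T) (vB T) in
  let b' := pdist (vA T') (vC T') in let c' := pdist (vA T') (vB T') in
  (c <= b /\ c' <= b') \/ (b <= c /\ b' <= c') -> congruent T T'.
Proof.
  intros H1 H2 HT HT' b c b' c' Side.
  apply solution_iff in HT as (S & _ & E); [|assumption..].
  apply solution_iff in HT' as (S' & _ & E'); [|assumption..].
  apply same_sides_congruent.
  apply (side_solution_eq_of_median_side l1 l2); try assumption. lra.
Qed.

(** By [median_bisector_gap], [4 * (x^2 - l2^2)] is [(b - c)^2] times a factor at least 1. *)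
Lemma solution_median_ge (l1 l2 x : R) (T : plane_triangle) :
  0 < l1 -> 0 < l2 -> solution l1 l2 x T ->
  l2 <= x /\ (pdist (vA T) (vC T) <> pdist (vA T) (vB T) <-> l2 < x).
Proof.
  intros H1 H2 HT.
  apply solution_iff in HT as (S & Hx & E); [|assumption..].
  destruct S as (A1 & A2 & A3 & A4 & _).
  rewrite (median_bisector_gap _ _ _ l2) in E by (assumption || lra).
  set (b := pdist (vA T) (vC T)) in *. set (c := pdist (vA T) (vB T)) in *.
  assert (Hk : 0 <= l2 ^ 2 / (b * c)) by (apply Rdiv_le_0_compat; nra).
  assert (Hsq := pow2_ge_0 (b - c)).
  split; [nra|]. split.
  - intros N. assert (0 < (b - c) ^ 2) by (apply pow2_gt_0; lra). nra.
  - intros L N. rewrite N in E. nra.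
Qed.

Theorem mainTheorem10 :
  forall l1 l2 : R, 0 < l2 -> l2 <= l1 ->
  forall x : R,
    (l2 < x < ma_star l1 l2 ->
       exists_exactly_two_triangles (solution l1 l2 x)) /\
    (ma_star l1 l2 <= x \/ x = l2 ->
       exists_unique_triangle (solution l1 l2 x)) /\
    (~ (l2 < x < ma_star l1 l2) -> ~ (ma_star l1 l2 <= x \/ x = l2) ->
       ~ exists T : plane_triangle, solution l1 l2 x T).
Proof.
  intros l1 l2 H2 H12 x. assert (H1 : 0 < l1) by lra.
  (* Outside the open range every solution thus lies on the branch c <= b, which holds at most
     one. *)
  assert (Hflat : forall T, solution l1 l2 x T ->
    pdist (vA T) (vC T) < pdist (vA T) (vB T) -> l2 < x < ma_star l1 l2).
  { intros T HT L. split.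
    - apply (solution_median_ge l1 l2 x T H1 H2 HT). lra.
    - apply solution_iff in HT as (S & _ & E); [|assumption..].
      apply (side_solution_median_lt_star _ _ _ _ _ _ H1 H2 S L). lra. }
  split; [|split].
  - intros Hx.
    destruct (side_solution_exists_tall l1 l2 x H1 ltac:(lra)) as (a & b & c & S & M & L).
    destruct (side_solution_exists_flat l1 l2 x H1 ltac:(lra) ltac:(lra))
      as (a' & b' & c' & S' & M' & L').
    destruct (solution_of_sides l1 l2 x a b c) as (T & HT & Ea & Eb & Ec);
      try assumption; [lra|].
    destruct (solution_of_sides l1 l2 x a' b' c') as (T' & HT' & Ea' & Eb' & Ec');
      try assumption; [lra|].
    exists T, T'. split; [exact HT|]. split; [exact HT'|]. split.
    (* [T] and [T'] lie on opposite branches, so equal sides would force b = c, excluded by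
       [l2 < x]. *)
    + intros (_ & Fb & Fc)%congruent_same_sides.
      apply (proj2 (proj2 (solution_median_ge l1 l2 x T H1 H2 HT))); lra.
    + intros T0 HT0.
      destruct (Rle_dec (pdist (vA T0) (vB T0)) (pdist (vA T0) (vC T0))) as [Side|Side].
      * left. apply (solutions_congruent l1 l2 x); try assumption. lra.
      * right. apply (solutions_congruent l1 l2 x); try assumption. lra.
  - intros Hx.
    (* [l2] is the harmonic mean of b* and c*, and m_a* their arithmetic mean. *)
    assert (Hl : l2 <= x).
    { destruct Hx as [Hx|Hx]; [|lra].
      destruct (star_spec l1 l2 H1 H2) as (B1 & B2 & B3 & _ & _ & B6 & B7).
      rewrite B7 in Hx. apply Rle_trans with (2 := Hx).
      apply Rmult_le_reg_r with (b_star l1 l2 + c_star l1 l2); [lra|].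
      rewrite B6. assert (H := pow2_ge_0 (b_star l1 l2 - c_star l1 l2)). lra. }
    destruct (side_solution_exists_tall l1 l2 x H1 ltac:(lra)) as (a & b & c & S & M & L).
    destruct (solution_of_sides l1 l2 x a b c) as (T & HT & Ea & Eb & Ec);
      try assumption; [lra|].
    exists T. split; [exact HT|]. intros T' HT'.
    apply (solutions_congruent l1 l2 x); try assumption. left. split; [|lra].
    apply Rnot_lt_le. intros L'. specialize (Hflat T' HT' L'). lra.
  - intros N1 N2 (T & HT).
    assert (Hm := proj1 (solution_median_ge l1 l2 x T H1 H2 HT)).
    destruct (Rle_lt_dec (ma_star l1 l2) x); [tauto|].
    destruct (Req_dec x l2); [tauto|]. apply N1. lra.
Qed.
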